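(* Every real nilpotent metrised Jordan algebra $(J,\gamma)$ of dimension $n$ with $\det\gamma=\pm1$ can be brought to semi-canonical form by an appropriate (linear) coordinate transformation. In addition, if $m$ is the number of blocks of size 2 in this form, then the partition $S$ can be chosen equal to $$\{\{1,n\},\{2,n-1\},\dots,\{m,n+1-m\},\{m+1\},\dots,\{n-m\}\},$$ and $\gamma$ may be chosen such that $\gamma(e_k,e_k)\ge\gamma(e_l,e_l)$ for all $m+1\le k<l\le n-m$.
   Context: A real Jordan algebra is a finite-dimensional real vector space with a commutative bilinear product $\bullet$ satisfying $x\bullet(x^2\bullet y)=x^2\bullet(x\bullet y)$ with $x^2=x\bullet x$. It is nilpotent if for some $m$ every product of $m$ elements vanishes. A trace form is a symmetric bilinear form $\gamma$ with $\gamma(u\bullet v,w)=\gamma(u,v\bullet w)$; $(J,\gamma)$ is metrised if $\gamma$ is a non-degenerate trace form on $J$. A real nilpotent metrised Jordan algebra $(J,\gamma)$ of dimension $n$, with linear coordinates and standard basis vectors $e_1,\dots,e_n$, is in semi-canonical form if: i) $x\bullet y\in\mathrm{span}\{e_1,\dots,e_{k-1}\}$ for every $x\in\mathrm{span}\{e_1,\dots,e_k\}$, $1\le k\le n$, and every $y\in J$; equivalently, the structure coefficients defined by $e_\alpha\bullet e_\beta=\sum_\delta K^\delta_{\alpha\beta}e_\delta$ satisfy $K^\delta_{\alpha\beta}=0$ whenever $\delta\ge\min(\alpha,\beta)$; ii) there exists a partition $S$ of $\{1,\dots,n\}$ into subsets of cardinality 1 or 2 such that the matrix of $\gamma$ is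 block-diagonal with respect to this partition with diagonal blocks equal to $+1$, $-1$, or $\begin{pmatrix}0&1\\1&0\end{pmatrix}$. *)

(* Defs.v *)
From mathcomp Require Export all_boot all_order all_algebra reals.

Set Implicit Arguments.
Unset Strict Implicit.
Unset Printing Implicit Defensive.

Import GRing.Theory Num.Theory.
Local Open Scope ring_scope.

Section Jordan.
Variables (R : realType) (J : vectType R).
Implicit Types (mul : {bilinear J -> J -> J}) (gamma : {symmetric J}).

Definition jordan mul : Prop :=
  commutative mul /\
  (forall x y, mul x (mul (mul x x) y) = mul (mul x x) (mul x y)).

(* [product_of mul m x]: x is a product of m elements of J, with an arbitrary
   arrangement of parentheses, as the algebra is not associative. *)
Inductive product_of mul : nat -> J -> Prop :=
| product_of_one x : product_of mul 1 x
| product_of_mul p q x y :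
    product_of mul p x -> product_of mul q y -> product_of mul (p + q) (mul x y).

(* There are no products of 0 elements, so m = 0 has to be excluded. *)
Definition nilpotent_algebra mul : Prop :=
  exists2 m : nat, (0 < m)%N & forall x, product_of mul m x -> x = 0.

Definition trace_form mul gamma : Prop :=
  forall u v w, gamma (mul u v) w = gamma u (mul v w).

Definition metrised mul gamma : Prop :=
  trace_form mul gamma /\ nondegenerate gamma.

Section Coordinates.
Variable n : nat.
Implicit Types (e : n.-tuple J) (S : {set {set 'I_n}}).

(* A choice of linear coordinates on J is a basis e of J; the vector
   usually written e_k, 1 <= k <= n, is tnth e (k - 1). *)

Definition gram gamma e : 'M[R]_n := \matrix_(i, j) gamma (tnth e i) (tnth e j).

Definition triangular mul e : Prop :=
  forall k : nat, (0 < k <= n)%N ->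
  forall x y, x \in <<take k e>>%VS -> mul x y \in <<take k.-1 e>>%VS.

Record block_form S (G : 'M[R]_n) : Prop := BlockForm {
  block_partition : partition S [set: 'I_n];
  block_card : forall B, B \in S -> #|B| = 1%N \/ #|B| = 2%N;
  block_diagonal : forall i j, pblock S i <> pblock S j -> G i j = 0;
  block_one : forall i, [set i] \in S -> G i i = 1 \/ G i i = -1;
  block_two : forall i j, i <> j -> [set i; j] \in S ->
    [/\ G i i = 0, G i j = 1, G j i = 1 & G j j = 0] }.

Definition semi_canonical mul gamma e S : Prop :=
  [/\ basis_of {:J} e, triangular mul e & block_form S (gram gamma e)].

End Coordinates.
End Jordan.

Definition num_two_blocks n (S : {set {set 'I_n}}) : nat :=
  #|[set B in S | #|B| == 2]|.

(* {{1, n}, ..., {m, n + 1 - m}, {m + 1}, ..., {n - m}}, shifted by one;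
   rev_ord i is n - 1 - i. *)
Definition std_partition (n m : nat) : {set {set 'I_n}} :=
  [set [set i; rev_ord i] | i : 'I_n & (i < m)%N] :|:
  [set [set i] | i : 'I_n & (m <= i < n - m)%N].

(* Main.v *)
Require Import Defs.
From mathcomp Require Import perm ring zify.

(** By nilpotency, every proper subspace U has a vector v outside U with J v
contained in U; this builds a full flag V_0 < ... < V_n with J V_k contained in
V_(k-1). A Gram-Schmidt process (relative position of the flag and the form)
yields a basis adapted to the flag in which [gamma] is a signed permutation
matrix of an involution s: take the first remaining vector e_i, and split off
e_i if it is anisotropic, and otherwise the hyperbolic plane spanned by e_i and
the first remaining e_j that is not orthogonal to it.

For the standard partition it suffices to permute the basis. The trilinear form
T(a,b,c) = gamma(e_a e_b, e_c) is totally symmetric, and condition i) says that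
T(a,b,c) <> 0 forces s(c) < a; by symmetry then s(a) < c as well. Listing first
the indices i < s(i) in increasing order, then the fixed points of s in any
order, and then the images under s of the first group in reverse order
preserves all these inequalities. *)

Set Implicit Arguments.
Unset Strict Implicit.
Unset Printing Implicit Defensive.

Import Order.TTheory GRing.Theory Num.Theory.
Local Open Scope ring_scope.

(** * Partitions into orbits of an involution *)

(** A fixed point gives a singleton block, since [[set i; i]] is [[set i]]. *)
Definition orbit_partition n (s : 'I_n -> 'I_n) : {set {set 'I_n}} :=
  [set [set i; s i] | i : 'I_n].

Section OrbitPartition.
Variables (n : nat) (s : 'I_n -> 'I_n).
Hypothesis sK : involutive s.

Lemma orbit_partition_trivIset : trivIset (orbit_partition s).
Proof.
apply/trivIsetP => _ _ /imsetP[i _ ->] /imsetP[j _ ->]; apply: contraR.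
case/pred0Pn => k /andP[/=]; rewrite !inE => /orP[]/eqP-> /orP[]/eqP.
- by move->.
- by move->; rewrite sK setUC.
- by move=> <-; rewrite sK setUC.
- by move/(can_inj sK)->.
Qed.

Lemma pblock_orbit_partition i : pblock (orbit_partition s) i = [set i; s i].
Proof.
by apply: (def_pblock orbit_partition_trivIset); [exact: imset_f | exact: set21].
Qed.

Lemma orbit_partitionP : partition (orbit_partition s) [set: 'I_n].
Proof.
apply/and3P; split; last 1 first.
- apply/imsetP=> -[i _ /setP/(_ i)]; by rewrite !inE eqxx.
- rewrite eqEsubset subsetT; apply/subsetP => i _.
  by apply/bigcupP; exists [set i; s i]; [exact: imset_f | exact: set21].
exact: orbit_partition_trivIset.
Qed.

(** Each two-element orbit is counted through its smaller element. *)
Lemma num_two_blocks_orbit :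
  num_two_blocks (orbit_partition s) = #|[set i : 'I_n | (i < s i)%N]|.
Proof.
rewrite /num_two_blocks -(card_in_imset (f := fun i : 'I_n => [set i; s i])).
  apply: eq_card => B; rewrite inE; apply/andP/imsetP => [[/imsetP[i _ ->]]|].
    rewrite cards2; case: (ltngtP i (s i)) => [lt_i _|gt_i _|/val_inj <-].
    - by exists i; rewrite ?inE.
    - by exists (s i); rewrite ?inE ?sK // setUC.
    - by rewrite eqxx.
  case=> i; rewrite inE => lt_i ->; split; first exact: imset_f.
  by rewrite cards2 -val_eqE neq_ltn lt_i.
move=> i j; rewrite !inE => lt_i lt_j eq_ij.
have: i \in [set j; s j] by rewrite -eq_ij set21.
rewrite !inE => /orP[]/eqP // def_i; move: lt_i lt_j.
by rewrite def_i sK => /ltn_trans h /h; rewrite ltnn.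
Qed.

End OrbitPartition.

(* Partial normal form reached by the Gram-Schmidt process: as s preserves A, the
   vectors already treated (indexed by A) are orthogonal to the remaining ones. *)
Definition normal_on (K : pzRingType) n (A : {set 'I_n}) (s : 'I_n -> 'I_n)
    (G : 'M[K]_n) :=
  forall i, i \in A -> [/\ s i \in A, s (s i) = i,
    forall j, j != s i -> G i j = 0 &
    if s i == i then G i i = 1 \/ G i i = -1 else G i (s i) = 1].

(** A partition into blocks of size 1 or 2 amounts to an involution, [s i] being the partner of [i]
    in its block; the row of index [i] of the Gram matrix is then supported at [s i]. *)
Lemma block_form_normal (R : realType) n (S : {set {set 'I_n}}) (G : 'M[R]_n) :
  block_form S G <->
  exists2 s : 'I_n -> 'I_n, S = orbit_partition s & normal_on setT s G.
Proof.
split=> [[Spart Scard Gdiag Gone Gtwo]|[s ->] Gn].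
  have [/eqP covS tiS S0] := and3P Spart.
  have inS i : i \in cover S by rewrite covS inE.
  have: forall i, exists j, pblock S i = [set i; j].
    move=> i; have iB : i \in pblock S i by rewrite mem_pblock inS.
    have [/eqP/cards1P[x defB]|/eqP/cards2P[x [y [_ defB]]]] :=
      Scard _ (pblock_mem (inS i)); move: iB; rewrite defB ?inE.
      by move/eqP->; exists x; rewrite setUid.
    by case/orP=> /eqP->; [exists y | exists x; rewrite setUC].
  case/fin_all_exists => s sP; exists s.
    apply/setP=> B; apply/idP/imsetP => [BS|[i _ ->]]; last first.
      by rewrite -sP pblock_mem ?inS.
    have [i iB] : exists i, i \in B.
      by apply/set0Pn; apply: contraNneq S0 => <-.
    by exists i; rewrite // -sP (def_pblock tiS BS iB).
  have spb i : pblock S (s i) = [set i; s i].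
    by rewrite -sP; apply: same_pblock; rewrite // sP set22.
  (* The sets {s i, s (s i)} and {i, s i} describe the same block. *)
  have sK i : s (s i) = i.
    have:= spb i; rewrite sP => /setP eqs.
    have:= eqs i; have:= eqs (s (s i)); rewrite !inE !eqxx !orbT /=.
    case/esym/orP=> /eqP // ->; case/orP=> /eqP //.
  have inSi i : [set i; s i] \in S by rewrite -sP pblock_mem ?inS.
  move=> i _; rewrite inE; split=> // [j|]; last first.
    case: eqP => [si|si].
      by apply: Gone; move: (inSi i); rewrite si setUid.
    by have [] := Gtwo _ _ (nesym si) (inSi i).
  have [-> /eqP si|ji j_si] := eqVneq j i.
    by have [] := Gtwo _ _ si (inSi i).
  apply: Gdiag; rewrite !sP => /setP/(_ j).
  by rewrite !inE eqxx (negPf ji) (negPf j_si).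
have sK i : s (s i) = i by have [] := Gn i (in_setT i).
split.
- exact: orbit_partitionP.
- by move=> _ /imsetP[i _ ->]; rewrite cards2; case: eqP; [left|right].
- move=> i j; rewrite !pblock_orbit_partition // => neq.
  have [_ _ G0 _] := Gn i (in_setT i); apply: G0.
  by apply/eqP=> def_j; apply: neq; rewrite def_j sK setUC.
- move=> i /(def_pblock (orbit_partition_trivIset sK))/(_ (set11 i)).
  rewrite pblock_orbit_partition // => /setP/(_ (s i)).
  rewrite !inE eqxx orbT => /esym si.
  by have [_ _ _] := Gn i (in_setT i); rewrite si.
move=> i j ij /(def_pblock (orbit_partition_trivIset sK))/(_ (set21 i j)).
rewrite pblock_orbit_partition // => /setP/(_ j).
rewrite !inE eqxx orbT => /orP[/eqP/esym //|/eqP def_j].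
have si : s i != i by rewrite -def_j; apply/eqP/nesym.
have [_ _ G0i] := Gn i (in_setT i); rewrite (negPf si) def_j => Gij.
have [_ _ G0j] := Gn (s i) (in_setT _); rewrite sK eq_sym (negPf si) => Gji.
by split; rewrite ?Gij ?Gji ?G0i ?G0j ?sK // eq_sym.
Qed.

(** * Reordering to the standard involution *)

Section StdInvolution.
Variables n m : nat.

Definition std_involution (k : 'I_n) : 'I_n :=
  if (m <= k < n - m)%N then k else rev_ord k.

Hypothesis le_2m : (m.*2 <= n)%N.

Lemma std_involutionK : involutive std_involution.
Proof.
move=> k; rewrite /std_involution.
have [mid_k|out_k] := boolP (m <= k < n - m)%N; first by rewrite mid_k.
rewrite ifN ?rev_ordK //=; apply: contra out_k; have := ltn_ord k; lia.
Qed.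

Lemma orbit_std_involution : orbit_partition std_involution = std_partition n m.
Proof.
apply/setP=> B; rewrite inE.
apply/imsetP/orP => [[k _ ->]|[]/imsetP[k]].
- rewrite /std_involution; case: ifPn => [mid_k|].
    by right; rewrite setUid; apply: imset_f; rewrite inE.
  rewrite negb_and -ltnNge -leqNgt => out_k; left.
  case/orP: (out_k) => [lt_k|ge_k]; first by apply/imsetP; exists k; rewrite ?inE.
  apply/imsetP; exists (rev_ord k); last by rewrite rev_ordK setUC.
  by rewrite inE /=; have := ltn_ord k; lia.
- by rewrite inE => lt_k ->; exists k => //; rewrite /std_involution leqNgt lt_k.
- by rewrite inE => mid_k ->; exists k => //; rewrite /std_involution mid_k setUid.
Qed.

End StdInvolution.

(** The map [p] reads off the word [w]: smaller elements of the 2-orbits in increasing order, fixed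
    points, partners in reverse order. The reversal makes [s] act on positions as
    [std_involution m]. The predicate [first_fixed] serves to sort the fixed points by sign. *)
Lemma involution_arrangement n (s : 'I_n -> 'I_n) (first_fixed : pred 'I_n) m :
    involutive s -> #|[set i : 'I_n | (i < s i)%N]| = m ->
  exists p : 'I_n -> 'I_n,
    [/\ (m.*2 <= n)%N, injective p,
        (forall k, s (p k) = p (std_involution m k)),
        (forall k : 'I_n, (k < m)%N -> (p k < s (p k))%N) &
        (forall k l : 'I_n, (k < l < m)%N -> (p k < p l)%N) /\
        (forall k l : 'I_n, (m <= k)%N -> (k < l)%N -> (l < n - m)%N ->
           first_fixed (p l) -> first_fixed (p k))].
Proof.
move=> sK card_m.
pose low := [seq i : 'I_n <- enum 'I_n | (i < s i)%N].
pose F b := [seq i : 'I_n <- enum 'I_n | (s i == i) && (first_fixed i == b)].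
pose w := low ++ (F true ++ F false) ++ rev (map s low).
have sizelow : size low = m.
  rewrite -card_m cardE; apply/perm_size/uniq_perm => [||i].
  - exact/filter_uniq/enum_uniq.
  - exact: enum_uniq.
  by rewrite mem_filter !mem_enum andbT inE.
have memF b i : i \in F b = (s i == i) && (first_fixed i == b).
  by rewrite mem_filter mem_enum andbT.
have memlow i : i \in low = (i < s i)%N by rewrite mem_filter mem_enum andbT.
have memhigh i : i \in rev (map s low) = (s i < i)%N.
  by rewrite mem_rev -{1}[i]sK mem_map ?memlow ?sK //; apply: can_inj sK.
have Uw : uniq w.
  have Uf q : uniq [seq i <- enum 'I_n | q i] by exact/filter_uniq/enum_uniq.
  rewrite !cat_uniq rev_uniq (map_inj_uniq (can_inj sK)) !Uf has_cat /=.
  rewrite negb_or -!andbA andbT; apply/and4P; split;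
    apply/hasPn => i /=; rewrite ?mem_cat ?memF ?memhigh ?memlow.
  - by case/orP=> /andP[/eqP-> _]; rewrite ltnn.
  - by move/ltnW; rewrite -leqNgt.
  - by case/andP=> _ /eqP->; rewrite andbF.
  - by rewrite -!andb_orr; case: eqP => [->|]; rewrite ?ltnn.
have memw i : i \in w.
  rewrite !mem_cat !memF memlow memhigh -andb_orr -val_eqE.
  by case: (first_fixed i); rewrite /= andbT; case: ltngtP.
have szw : size w = n.
  rewrite -[RHS]card_ord cardE; apply/perm_size/uniq_perm => [||i]; first exact: Uw.
    exact: enum_uniq.
  by rewrite memw mem_enum.
have szF : size (F true ++ F false) = (n - m.*2)%N.
  by move: szw; rewrite !size_cat size_rev size_map sizelow; lia.
have le_2m : (m.*2 <= n)%N.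
  by rewrite -szw !size_cat size_rev size_map sizelow; lia.
(* As [w] has length [n], the default is never reached; [k] itself is at hand even though ['I_n] may
   be empty. *)
pose p (k : 'I_n) := nth k w k.
have pE k0 k : p k = nth k0 w k by apply: set_nth_default; rewrite szw.
have p_low k0 (k : 'I_n) : (k < m)%N -> p k = nth k0 low k.
  by move=> lt_k; rewrite (pE k0) nth_cat sizelow lt_k.
have p_mid k0 (k : 'I_n) : (m <= k < n - m)%N ->
    p k = nth k0 (F true ++ F false) (k - m).
  move=> mid_k; rewrite (pE k0) [LHS]nth_cat sizelow ltnNge.
  by case/andP: (mid_k) => -> _ /=; rewrite [LHS]nth_cat szF ifT //; lia.
have p_low_lt (k : 'I_n) : (k < m)%N -> (p k < s (p k))%N.
  by move=> lt_k; rewrite -memlow (p_low k) // mem_nth ?sizelow.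
have p_rev (k : 'I_n) : (k < m)%N -> p (rev_ord k) = s (p k).
  move=> lt_k; rewrite (pE k) (p_low k) // /w catA nth_cat size_cat szF sizelow /=.
  rewrite ifF; last by have := ltn_ord k; lia.
  rewrite nth_rev ?size_map sizelow; last by have := ltn_ord k; lia.
  rewrite (nth_map k) ?sizelow; last by have := ltn_ord k; lia.
  by congr (s (nth _ _ _)); have := ltn_ord k; lia.
have p_fixed (k : 'I_n) : (m <= k < n - m)%N -> s (p k) = p k.
  move=> mid_k.
  have: p k \in F true ++ F false by rewrite (p_mid k) // mem_nth ?szF; lia.
  by rewrite mem_cat !memF => /orP[]/andP[/eqP].
exists p; split=> //.
- move=> k l; rewrite (pE k k) (pE k l) => /eqP.
  by rewrite nth_uniq ?szw // => /eqP/val_inj.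
- move=> k; rewrite /std_involution; case: ifPn => [/p_fixed //|].
  rewrite negb_and -ltnNge -leqNgt => out_k.
  case: (ltnP k m) => [/p_rev -> //|le_k].
  by rewrite -{1}[k]rev_ordK p_rev ?sK //=; have := ltn_ord k; lia.
split=> k l.
  case/andP=> lt_kl lt_l; rewrite !(p_low k) ?(ltn_trans lt_kl) //.
  (* [low] is a subsequence of the enumeration of ['I_n]. *)
  have sorted_low : sorted ltn (map val low).
    have: subseq (map val low) (iota 0 n).
      by rewrite -val_enum_ord map_subseq ?filter_subseq.
    by move/(subseq_sorted ltn_trans); apply; apply: iota_ltn_sorted.
  rewrite -!(nth_map k (val k) val) ?sizelow ?(ltn_trans lt_kl) //.
  by apply: (sorted_ltn_nth ltn_trans (val k) sorted_low) => //;
    rewrite inE size_map sizelow // (ltn_trans lt_kl).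
move=> le_k lt_kl lt_l.
rewrite !(p_mid k) ?le_k ?(leq_trans le_k (ltnW lt_kl)) ?(ltn_trans lt_kl) //.
(* If [p l] comes from [F true], so does [p k]; otherwise [p l] comes from [F false] and the premise
   fails. *)
rewrite !nth_cat; case: ifPn => [lt_l1 _|].
  have lt_k1 : (k - m < size (F true))%N.
    by apply: leq_ltn_trans lt_l1; rewrite leq_sub2r // ltnW.
  rewrite lt_k1.
  by have := mem_nth k lt_k1; rewrite memF => /andP[_ /eqP].
rewrite -leqNgt => ge_l; set x := nth _ _ _.
suff: x \in F false by rewrite memF => /andP[_ /eqP->].
by rewrite mem_nth // ltn_subLR // -size_cat szF; lia.
Qed.

(** * Triangularity in terms of the form *)

Lemma normal_on_neq0 (K : idomainType) n A s (G : 'M[K]_n) i :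
  normal_on A s G -> i \in A -> G i (s i) != 0.
Proof.
move=> Gn /Gn[_ _ _]; case: (s i =P i) => [->|_ ->]; last exact: oner_neq0.
by case=> ->; rewrite ?oppr_eq0 oner_eq0.
Qed.

Section Forms.
Variables (R : realType) (J : vectType R) (gamma : {symmetric J}) (n : nat).
Implicit Types (e : n.-tuple J) (mul : {bilinear J -> J -> J}).

Lemma form_sym u v : gamma u v = gamma v u.
Proof. by rewrite hermC expr0 mul1r. Qed.

Lemma formZl a u v : gamma (a *: u) v = a * gamma u v.
Proof. exact: linearZl_LR. Qed.

Lemma formZr a u v : gamma u (a *: v) = a * gamma u v.
Proof. by rewrite form_sym formZl form_sym. Qed.

Lemma formDl u v w : gamma (u + v) w = gamma u w + gamma v w.
Proof. exact: linearDl. Qed.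

Lemma formDr u v w : gamma u (v + w) = gamma u v + gamma u w.
Proof. exact: linearDr. Qed.

Lemma form_suml I r (P : pred I) (u : I -> J) v :
  gamma (\sum_(i <- r | P i) u i) v = \sum_(i <- r | P i) gamma (u i) v.
Proof. exact: linear_sumlz. Qed.

Lemma mem_take_tnth e (i : 'I_n) k : (i < k)%N -> tnth e i \in take k e.
Proof.
move=> lt_ik; rewrite (tnth_nth 0) -(nth_take _ lt_ik) mem_nth //.
by rewrite size_take size_tuple; case: ifP.
Qed.

Lemma span_take_subP e k (U : {vspace J}) :
  reflect (forall i : 'I_n, (i < k)%N -> tnth e i \in U) (<<take k e>> <= U)%VS.
Proof.
apply: (iffP span_subvP) => [sub i lt_ik|sub v].
  exact/sub/mem_take_tnth.
case/(nthP 0) => i; rewrite size_take_min size_tuple leq_min => /andP[lt_ik lt_in].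
by rewrite nth_take // => <-; rewrite -(tnth_nth 0 e (Ordinal lt_in)) sub.
Qed.

(** Up to signs, the vectors of index [s l] form the basis dual to [e], so these pairings read off
    the coordinates of [x] of index at least [k]. *)
Lemma normal_span_takeP e s k x :
    basis_of {:J} e -> normal_on setT s (gram gamma e) ->
  x \in <<take k e>>%VS <->
  forall l : 'I_n, (k <= l)%N -> gamma x (tnth e (s l)) = 0.
Proof.
move=> e_basis e_normal.
have sK i : s (s i) = i by have [] := e_normal i (in_setT i).
have e0 i j : j != s i -> gamma (tnth e i) (tnth e j) = 0.
  by have [_ _ /(_ j)] := e_normal i (in_setT i); rewrite mxE.
split=> [xk l le_kl|x0].
  (* Orthogonality to a fixed vector defines a subspace, so it is enough to test the spanning
     vectors. *)
  apply/eqP; rewrite -mem_orthov1; apply: subvP xk; apply/span_take_subP => i lt_ik.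
  rewrite mem_orthov1 e0 //; apply: contraTneq lt_ik => /(can_inj sK) <-.
  by rewrite -leqNgt.
rewrite (coord_basis e_basis (memvf x)); apply: memv_suml => i _.
have [lt_ik|le_ki] := ltnP i k.
  by apply/memvZ/memv_span; rewrite -tnth_nth mem_take_tnth.
suff -> : coord e i x = 0 by rewrite scale0r mem0v.
apply/eqP; have /eqP := x0 i le_ki.
rewrite {1}(coord_basis e_basis (memvf x)) form_suml (bigD1 i) //= big1 => [|j ji].
  rewrite addr0 formZl mulf_eq0 -tnth_nth => /orP[//|g0].
  by have := normal_on_neq0 e_normal (in_setT i); rewrite mxE => /negP[].
by rewrite formZl -tnth_nth e0 ?mulr0 // (inj_eq (can_inj sK)) eq_sym.
Qed.

(** By duality, pairing a product with the vector of index [c] tests its coordinate of index [s c];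
    triangularity asks this to vanish from index [a] on. Bilinearity reduces the factors to basis
    vectors. *)
Lemma normal_triangularP mul e s :
    basis_of {:J} e -> normal_on setT s (gram gamma e) -> trace_form mul gamma ->
  triangular mul e <->
  forall a b c : 'I_n, (a <= s c)%N ->
    gamma (mul (tnth e a) (tnth e b)) (tnth e c) = 0.
Proof.
move=> e_basis e_normal tr.
have sK i : s (s i) = i by have [] := e_normal i (in_setT i).
have spanP k x := normal_span_takeP k x e_basis e_normal.
split=> [tri a b c le_ac|T0 k /andP[k_gt0 le_kn] x y xk].
  rewrite -[c]sK; apply: (spanP a _).1 => //.
  (* Indices start at 0: the vector of index [a] is the last of the first [a.+1], so the product
     lies in the span of the first [a]. *)
  by apply: (tri a.+1); rewrite ?ltn_ord // memv_span ?mem_take_tnth.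
(* The trace identity isolates [x] in the first argument, so that it can be replaced by spanning
   vectors. *)
apply/spanP => l le_kl; apply/eqP; rewrite tr -mem_orthov1.
apply: subvP xk; apply/span_take_subP => i lt_ik.
rewrite mem_orthov1 -tr (coord_basis e_basis (memvf y)) linear_sumr form_suml.
rewrite big1 // => j _; rewrite linearZr_LR formZl -tnth_nth T0 ?mulr0 //.
by rewrite sK; lia.
Qed.

End Forms.

(** * Triangular bases from nilpotency *)

Section Nilpotent.
Variables (R : realType) (J : vectType R) (mul : {bilinear J -> J -> J}).
Hypothesis mul_nil : nilpotent_algebra mul.

(** Otherwise every vector outside [U] has a multiple outside [U]; iteration gives nonzero products
    of every length, against nilpotency. *)
Lemma nilpotent_annihilated_mod (U : {vspace J}) :
  U != {:J}%VS -> exists2 v, v \notin U & forall y, mul y v \in U.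
Proof.
move=> nU; have [//|no_v] :=
  boolp.pselect (exists2 v, v \notin U & forall y, mul y v \in U).
have step v : v \notin U -> exists y, mul y v \notin U.
  move=> vU; case: (boolp.pselect (exists y, mul y v \notin U)) => // no_y.
  case: no_v; exists v => // y; apply/negPn/negP => yU; apply: no_y; by exists y.
have long p : exists2 x, x \notin U & product_of mul p.+1 x.
  elim: p => [|p [x xU px]].
    have /subvPn[x _ xU] : ~~ ({:J} <= U)%VS.
      by apply: contra nU => sub; rewrite eqEsubv subvf.
    by exists x => //; constructor.
  have [y yxU] := step x xU; exists (mul y x) => //.
  by apply: (product_of_mul (p := 1)) px; constructor.
have [[//|m] _ zero] := mul_nil; have [x + /zero x0] := long m.
by rewrite x0 mem0v.
Qed.

(** Vectors are chosen one after another, each sent by all multiplications into the span of its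
    predecessors. *)
Lemma nilpotent_triangular_basis n : \dim {:J} = n -> commutative mul ->
  exists2 e : n.-tuple J, basis_of {:J} e & triangular mul e.
Proof.
move=> dimJ mulC.
have [e [e_free eP]] : exists e : n.-tuple J, free e /\
    forall (i : 'I_n) y, mul y (tnth e i) \in <<take i e>>%VS.
  suff: forall k, (k <= n)%N -> exists s : seq J, [/\ size s = k, free s &
      forall i y, (i < k)%N -> mul y (nth 0 s i) \in <<take i s>>%VS].
    case/(_ n (leqnn n)) => s [/eqP szs s_free sP].
    by exists (Tuple szs); split=> // i y; rewrite (tnth_nth 0) sP.
  elim=> [_|k IHk lt_kn]; first by exists [::]; rewrite nil_free.
  have [s [szs s_free sP]] := IHk (ltnW lt_kn).
  have [|v vs vP] := @nilpotent_annihilated_mod <<s>>%VS.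
    apply: contraTneq lt_kn => spans.
    by rewrite -dimJ -spans -leqNgt (eqP s_free) szs.
  exists (rcons s v); split; first by rewrite size_rcons szs.
    rewrite -cats1.
    by rewrite (perm_free (_ : perm_eq _ (v :: s))) ?free_cons ?vs // perm_catC.
  move=> i y; rewrite ltnS nth_rcons szs leq_eqVlt => /orP[/eqP->|lt_ik].
    by rewrite ltnn eqxx -cats1 take_cat szs ltnn subnn take0 cats0.
  by rewrite lt_ik -cats1 take_cat szs lt_ik sP.
exists e; first by rewrite basisEfree e_free subvf size_tuple dimJ leqnn.
move=> k /andP[k_gt0 le_kn] x y xk; rewrite mulC.
pose U := (linfun (mul y) @^-1: <<take k.-1 e>>)%VS.
suff: x \in U by rewrite -memv_preim lfunE.
apply: subvP xk; apply/span_take_subP => i lt_ik.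
rewrite -memv_preim lfunE /=.
apply: subvP (eP i y); apply/span_take_subP => j lt_ji.
by apply/memv_span/mem_take_tnth; lia.
Qed.

End Nilpotent.

(** * Bases adapted to a flag *)

Section FlagNormalForm.
Variables (R : realType) (J : vectType R) (gamma : {symmetric J}) (n : nat).
Variable V : nat -> {vspace J}.
Hypotheses (dimV : forall k, (k <= n)%N -> \dim (V k) = k).
Hypotheses (subV : forall k, (k < n)%N -> (V k <= V k.+1)%VS).
Implicit Types (e : n.-tuple J) (A : {set 'I_n}).

Lemma flag_subv k l : (k <= l <= n)%N -> (V k <= V l)%VS.
Proof.
elim: l => [|l IHl] /andP[]; first by rewrite leqn0 => /eqP->.
rewrite leq_eqVlt => /orP[/eqP-> //|le_kl lt_ln].
by apply: subv_trans (subV lt_ln); rewrite IHl // -ltnS le_kl ltnW.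
Qed.

(** Stated vector by vector, so that a modified basis can be checked one index at a time. *)
Definition adapted e :=
  forall k : 'I_n, tnth e k \in V k.+1 /\ tnth e k \notin V k.

Lemma adapted_span e k : adapted e -> (k <= n)%N -> <<take k e>>%VS = V k.
Proof.
move=> e_ad; elim: k => [_|k IHk lt_kn].
  by rewrite take0 span_nil; apply/esym/eqP; rewrite -dimv_eq0 dimV.
have [ek1 ek] := e_ad (Ordinal lt_kn).
rewrite (take_nth 0) ?size_tuple // -cats1 span_cat IHk ?(ltnW lt_kn) // span_seq1.
rewrite (tnth_nth 0) /= in ek1 ek.
apply/eqP; rewrite eqEdim subv_add subV // -memvE ek1 dimV //=.
rewrite -{1}(dimV (ltnW lt_kn)) ltn_neqAle (dimv_leqif_eq (addvSl _ _)).
rewrite dimvS ?addvSl // andbT; apply: contra ek => /eqP ->.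
by rewrite memvE addvSr.
Qed.

(** Modulo [V k], the new vector is a nonzero multiple of the old one. *)
Lemma adapted_update e (k : 'I_n) c u v :
  adapted e -> c != 0 -> u \in V k -> v = c *: tnth e k + u ->
  v \in V k.+1 /\ v \notin V k.
Proof.
move=> e_ad c0 uV ->; have [ek1 ek] := e_ad k; split.
  by rewrite memvD ?memvZ // (subvP (subV _)).
by rewrite rpredDr ?rpredZeq ?(negPf c0).
Qed.

Hypothesis gamma_nondeg : forall v, (forall w, gamma v w = 0) -> v = 0.
Hypothesis dimJ : \dim {:J} = n.

Lemma adapted_basis e : adapted e -> basis_of {:J} e.
Proof.
move=> e_ad; rewrite basisEdim size_tuple dimJ leqnn andbT.
have := adapted_span e_ad (leqnn n).
rewrite take_oversize ?size_tuple // => ->.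
suff -> : V n = {:J}%VS by [].
by apply/eqP; rewrite eqEdim subvf dimV // dimJ leqnn.
Qed.

(** Since [s] maps [A] to itself, changing vectors outside [A] is harmless as long as they stay
    orthogonal to those in [A]. *)
Lemma normal_on_update A s e (e' : n.-tuple J) :
    normal_on A s (gram gamma e) ->
    (forall k, k \in A -> tnth e' k = tnth e k) ->
    (forall k j, k \in A -> j \notin A -> gamma (tnth e k) (tnth e' j) = 0) ->
  normal_on A s (gram gamma e').
Proof.
move=> eA e'A e'0 i iA; have [siA ssi G0 G1] := eA i iA.
split=> // [j j_si|]; rewrite !mxE; last by move: G1; rewrite !mxE !e'A.
rewrite e'A //; have [jA|jA] := boolP (j \in A); last by rewrite e'0.
by rewrite e'A //; have := G0 j j_si; rewrite mxE.
Qed.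

(** The minimal choices of [i] and [j] ensure that a vector is only corrected by multiples of
    vectors from earlier steps of the flag, so the basis stays adapted. *)
Lemma normal_on_extend A s e : adapted e -> A != setT ->
    normal_on A s (gram gamma e) ->
  exists A' s' e',
    [/\ A \proper A', adapted e' & normal_on A' s' (gram gamma e')].
Proof.
move=> e_ad nA eA.
have e0 k j : k \in A -> j \notin A -> gamma (tnth e k) (tnth e j) = 0.
  move=> kA jA; have [skA _ /(_ j) + _] := eA k kA; rewrite mxE; apply.
  by apply: contraNneq jA => ->.
have [i0 i0A] : exists i0, i0 \notin A.
  by move: nA; rewrite -subTset => /subsetPn[i0 _]; exists i0.
(* Every other remaining index [k] exceeds [i], hence [ei] lies in [V k]. *)
have [i iA imin] := @arg_minnP _ i0 (fun i => i \notin A) val i0A.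
pose ei := tnth e i; have ei0 k : k \in A -> gamma (tnth e k) ei = 0.
  by move=> kA; apply: e0.
have lt_i k : k \notin A -> k != i -> (i < k)%N.
  by move=> kA ki; rewrite ltn_neqAle eq_sym ki imin.
have eiV k : k \notin A -> k != i -> ei \in V k.
  move=> kA /lt_i lt_ik; apply: subvP (e_ad i).1.
  by rewrite flag_subv // lt_ik //= ltnW.
have [gii|gii] := eqVneq (gamma ei ei) 0; last first.
  (* Scaling by [c] replaces [gamma ei ei] by its sign. *)
  pose c := (Num.sqrt `|gamma ei ei|)^-1.
  have c0 : c != 0 by rewrite invr_eq0 sqrtr_eq0 -ltNge normr_gt0.
  have cc : c * (c * gamma ei ei) = Num.sg (gamma ei ei).
    rewrite mulrA -expr2 exprVn sqr_sqrtr // {2}[gamma ei ei]numEsg.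
    by rewrite mulrCA mulVf ?mulr1 // normr_eq0.
  pose e' := [tuple if k \in A then tnth e k else if k == i then c *: ei
                    else tnth e k - (gamma ei (tnth e k) / gamma ei ei) *: ei
              | k < n].
  pose s' k := if k == i then i else s k.
  exists (i |: A), s', e'; split.
  - by rewrite properUr // sub1set.
  - move=> k; rewrite tnth_mktuple; case: ifPn => [_|kA]; first exact: e_ad.
    case: eqVneq => [->|ki].
      by apply: (adapted_update e_ad c0 (mem0v _)); rewrite addr0.
    apply: (adapted_update (u := - _) e_ad (oner_neq0 _)); last by rewrite scale1r.
    by rewrite memvN memvZ ?eiV.
  have e'A : normal_on A s (gram gamma e').
    apply: normal_on_update eA _ _ => [k kA|k j kA jA]; rewrite tnth_mktuple ?kA //.
    rewrite (negPf jA); case: ifP => _; first by rewrite formZr ei0 ?mulr0.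
    by rewrite formDr -scaleNr formZr e0 // ei0 // mulr0 addr0.
  move=> k; rewrite in_setU1 /s'; have [-> _|ki /= kA] := eqVneq k i.
    rewrite eqxx setU11; split=> // [j ji|];
      rewrite !mxE !tnth_mktuple (negPf iA) eqxx.
      rewrite formZl (negPf ji); case: ifPn => [/ei0|jA].
        by rewrite form_sym => ->; rewrite mulr0.
      by rewrite formDr -scaleNr formZr mulNr divfK // subrr mulr0.
    rewrite formZl formZr cc; have := gii.
    by case: sgrP => _; rewrite ?eqxx; [|left|right].
  have [skA ssk Gk0 Gk1] := e'A k kA.
  have ski : s k != i by apply: contraNneq iA => <-.
  by rewrite in_setU1 skA orbT (negPf ski); split.
(* By nondegeneracy some basis vector is not orthogonal to [ei]; its index is outside [A], as the
   vectors in [A] are orthogonal to [ei]. *)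
have [j1 /andP[j1A j10]] : exists j, (j \notin A) && (gamma ei (tnth e j) != 0).
  apply/existsP; apply: contraNT (e_ad i).2; rewrite negb_exists => /forallP all0.
  suff -> : tnth e i = 0 by exact: mem0v.
  apply: gamma_nondeg => w.
  rewrite form_sym (coord_basis (adapted_basis e_ad) (memvf w)) form_suml.
  rewrite big1 // => l _; rewrite formZl -tnth_nth.
  suff -> : gamma (tnth e l) (tnth e i) = 0 by rewrite mulr0.
  have := all0 l; rewrite negb_and !negbK => /orP[/ei0 //|/eqP <-].
  by rewrite form_sym.
have := @arg_minnP _ j1 (fun j => (j \notin A) && (gamma ei (tnth e j) != 0)) val.
rewrite j1A j10 => /(_ isT)[j /andP[jA gij] jmin].
have ji : j != i by apply: contraNneq gij => ->; rewrite -/ei gii.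
(* The first coefficient makes the pairing with [ei] equal to 1, the second makes [f] isotropic. *)
pose f := (gamma ei (tnth e j))^-1 *: tnth e j
          - (gamma (tnth e j) (tnth e j) / (2 * gamma ei (tnth e j) ^+ 2)) *: ei.
have gif : gamma ei f = 1.
  by rewrite formDr -scaleNr !formZr gii mulr0 addr0 mulVf.
have gff : gamma f f = 0.
  rewrite {1}/f formDl -scaleNr !formZl gif form_sym formDr -scaleNr !formZr.
  by rewrite (form_sym _ _ ei); field; rewrite gij.
have f0 k : k \in A -> gamma (tnth e k) f = 0.
  by move=> kA; rewrite formDr -scaleNr !formZr e0 ?ei0 // !mulr0 addr0.
(* A multiple of [f] is subtracted only from vectors not orthogonal to [ei]; for these, minimality
   gives [j < k]. *)
have fV k : k \notin A -> k != j -> gamma ei (tnth e k) != 0 -> f \in V k.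
  move=> kA kj gik; have lt_jk : (j < k)%N.
    by rewrite ltn_neqAle eq_sym kj jmin // kA.
  rewrite memvB ?memvZ //; last first.
    by apply: eiV => //; apply: contraTneq lt_jk => ->; rewrite -leqNgt ltnW ?lt_i.
  apply: subvP (e_ad j).1.
  by rewrite flag_subv // lt_jk //= ltnW.
have fE := erefl f; rewrite {2}/f in fE; clearbody f.
(* Orthogonal projection off the hyperbolic plane: [ei] and [f] are isotropic and dual to each
   other, so the coefficient along either one is the pairing with the other. *)
pose e' := [tuple if k \in A then tnth e k else if k == i then ei else
                  if k == j then f else
                  tnth e k - gamma ei (tnth e k) *: f - gamma (tnth e k) f *: ei
            | k < n].
pose s' k := if k == i then j else if k == j then i else s k.
exists (i |: (j |: A)), s', e'; split.
- rewrite properE; apply/andP; split.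
    by apply/subsetP => k kA; rewrite !inE kA !orbT.
  by apply/subsetPn; exists i; rewrite ?setU11.
- move=> k; rewrite tnth_mktuple; case: ifPn => [_|kA]; first exact: e_ad.
  have [->|ki] := eqVneq k i; first exact: e_ad.
  have [->|kj] := eqVneq k j.
    apply: (adapted_update e_ad _ _ fE); first by rewrite invr_eq0.
    by rewrite memvN memvZ ?eiV.
  apply: (adapted_update (u := - _ - _) e_ad (oner_neq0 _)); last first.
    by rewrite scale1r addrA.
  rewrite memvB ?memvN ?(memvZ _ (eiV _ _ _)) //.
  have [->|gik] := eqVneq (gamma ei (tnth e k)) 0; first by rewrite scale0r mem0v.
  by rewrite memvZ ?fV.
have e'A : normal_on A s (gram gamma e').
  apply: normal_on_update eA _ _ => [k kA|k l kA lA]; rewrite tnth_mktuple ?kA //.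
  rewrite (negPf lA); case: ifP => _; first exact: ei0.
  case: ifP => _; first exact: f0.
  by rewrite !formDr -!scaleNr !formZr e0 // ei0 // f0 // !mulr0 !addr0.
have e'ij k : k != i -> k != j ->
    gamma ei (tnth e' k) = 0 /\ gamma f (tnth e' k) = 0.
  move=> ki kj; rewrite tnth_mktuple (negPf ki) (negPf kj).
  case: ifPn => [kA|kA]; first by rewrite !(form_sym _ _ (tnth e k)) ei0 ?f0.
  rewrite !formDr -!scaleNr !formZr gii gif gff (form_sym _ f ei) gif.
  by rewrite (form_sym _ f); split; ring.
have e'i : tnth e' i = ei by rewrite tnth_mktuple (negPf iA) eqxx.
have e'j : tnth e' j = f by rewrite tnth_mktuple (negPf jA) (negPf ji) eqxx.
move=> k; rewrite !in_setU1 /s'; have [-> _|ki /=] := eqVneq k i.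
  rewrite (negPf ji) !eqxx; split=> // [l lj|];
    rewrite ?mxE ?e'i ?e'j ?eqxx ?orbT ?gif //.
  have [->|li] := eqVneq l i; first by rewrite e'i.
  by have [] := e'ij l li lj.
have [-> _|kj /= kA] := eqVneq k j.
  rewrite !eqxx eq_sym (negPf ji); split=> // [l li|]; rewrite ?mxE ?e'i ?e'j.
  - have [->|lj] := eqVneq l j; first by rewrite e'j.
    by have [] := e'ij l li lj.
  - by rewrite form_sym.
have [skA ssk Gk0 Gk1] := e'A k kA.
have ski : s k != i by apply: contraNneq iA => <-.
have skj : s k != j by apply: contraNneq jA => <-.
by rewrite skA !orbT (negPf ski) (negPf skj); split.
Qed.

(** Extension is iterated from the empty set; [m] bounds the number of untreated indices. *)
Lemma flag_normal_form e : adapted e ->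
  exists s e', adapted e' /\ normal_on setT s (gram gamma e').
Proof.
move=> e_ad.
suff ext m A s e1 : (#|~: A| <= m)%N -> adapted e1 ->
    normal_on A s (gram gamma e1) ->
    exists s' e', adapted e' /\ normal_on setT s' (gram gamma e').
  apply: (ext n set0 id e) => //; last by move=> i; rewrite inE.
  by rewrite setC0 cardsT card_ord.
elim: m A s e1 => [|m IHm] A s e1 szA e1_ad e1A;
    (have [AT|nA] := eqVneq A setT; first by exists s, e1; rewrite -AT).
  case/negP: nA; rewrite -[A]setCK (eqP (_ : ~: A == set0)) ?setC0 //.
  by rewrite -cards_eq0 -leqn0.
have [A' [s' [e' [/proper_card lt_A e'_ad e'A]]]] := normal_on_extend e1_ad nA e1A.
apply: (IHm A' s' e') => //.
by have := cardsC A; have := cardsC A'; rewrite card_ord; lia.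
Qed.

End FlagNormalForm.

(** * Semi-canonical forms *)

Lemma nondegenerate_eq0 (R : realType) (J : vectType R) (gamma : {symmetric J}) v :
  nondegenerate gamma -> (forall w, gamma v w = 0) -> v = 0.
Proof.
move=> /eqP rad0 v0; apply/eqP; rewrite -memv0 -rad0.
by apply/mem_orthovP => w _; apply: v0.
Qed.

Lemma free_span_take_dim (R : realType) (J : vectType R) n (b : n.-tuple J) k :
  free b -> (k <= n)%N -> \dim <<take k b>> = k.
Proof.
move=> b_free le_kn; have: free (take k b).
  by apply: (@catl_free _ _ (drop k b)); rewrite cat_take_drop.
by move/eqP->; rewrite size_takel // size_tuple.
Qed.

(** The normalised basis is adapted to the flag of a triangular basis, and triangularity depends
    only on the flag. *)
Lemma semi_canonical_exists (R : realType) (J : vectType R) n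
    (mul : {bilinear J -> J -> J}) (gamma : {symmetric J}) :
    \dim {:J} = n -> commutative mul -> nilpotent_algebra mul ->
    nondegenerate gamma ->
  exists (e : n.-tuple J) (S : {set {set 'I_n}}), semi_canonical mul gamma e S.
Proof.
move=> dimJ mulC mul_nil nondeg.
have [b b_basis b_tri] := nilpotent_triangular_basis mul_nil dimJ mulC.
have b_free := basis_free b_basis.
pose V k := <<take k b>>%VS.
have dimV k : (k <= n)%N -> \dim (V k) = k by apply: free_span_take_dim.
have subV k : (k < n)%N -> (V k <= V k.+1)%VS.
  by move=> _; apply/span_take_subP => i lt_ik; apply/memv_span/mem_take_tnth/ltnW.
have b_ad : adapted V b.
  move=> k; split; first exact/memv_span/mem_take_tnth.
  apply/negP => bk; have := dimV k.+1 (ltn_ord k).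
  rewrite /V (take_nth 0) ?size_tuple // -cats1 span_cat span_seq1 -tnth_nth.
  by rewrite (addv_idPl bk) (dimV k (ltnW (ltn_ord k))); lia.
have gamma0 v := @nondegenerate_eq0 _ _ gamma v nondeg.
have [s [e [e_ad e_normal]]] := flag_normal_form dimV subV gamma0 dimJ b_ad.
exists e, (orbit_partition s); split.
- exact: adapted_basis e_ad.
- move=> k /andP[k_gt0 le_kn] x y.
  rewrite !(adapted_span dimV subV e_ad) //; last by lia.
  by apply: b_tri; rewrite k_gt0.
by apply/block_form_normal; exists s.
Qed.

Lemma semi_canonical_std (R : realType) (J : vectType R) n
    (mul : {bilinear J -> J -> J}) (gamma : {symmetric J})
    (e : n.-tuple J) (S : {set {set 'I_n}}) :
    commutative mul -> trace_form mul gamma -> semi_canonical mul gamma e S ->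
  exists e' : n.-tuple J,
    semi_canonical mul gamma e' (std_partition n (num_two_blocks S)) /\
    (forall k l : 'I_n, (num_two_blocks S <= k)%N -> (k < l)%N ->
       (l < n - num_two_blocks S)%N ->
       gamma (tnth e' l) (tnth e' l) <= gamma (tnth e' k) (tnth e' k)).
Proof.
move=> mulC tr [e_basis e_tri /block_form_normal[s -> e_normal]].
have sK : involutive s by move=> i; have [] := e_normal i (in_setT i).
rewrite num_two_blocks_orbit //; set m := #|_|.
(* Used as [first_fixed], this lists the blocks +1 before the blocks -1. *)
pose plus i := gamma (tnth e i) (tnth e i) == 1.
have [p [le_2m p_inj sp p_low [p_mono p_sort]]] :=
  @involution_arrangement n s plus m sK erefl.
set t := std_involution m in sp.
have tK : involutive t := std_involutionK le_2m.
pose e' := [tuple tnth e (p k) | k < n].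
have e'E k : tnth e' k = tnth e (p k) by rewrite tnth_mktuple.
have e'_basis : basis_of {:J} e'.
  rewrite (perm_basis (Y := e)) //; apply/tuple_permP; exists (perm p_inj).
  by congr tval; apply: eq_from_tnth => k; rewrite !tnth_mktuple permE.
have e'_normal : normal_on setT t (gram gamma e').
  move=> k _; have [_ _ G0 G1] := e_normal (p k) (in_setT _).
  rewrite in_setT; split=> // [l lt|]; rewrite !mxE !e'E.
    by have := G0 (p l); rewrite mxE; apply; rewrite sp (inj_eq p_inj).
  by move: G1; rewrite !mxE sp (inj_eq p_inj).
(* The three groups of positions: [p k] is smaller than, equal to or larger than its partner. *)
have zone (k : 'I_n) :
  [\/ [/\ (k < m)%N, t k = (n - k.+1)%N :> nat & (p k < s (p k))%N],
    [/\ (m <= k < n - m)%N, t k = k & s (p k) = p k :> nat]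
  | [/\ (n - m <= k)%N, t k = (n - k.+1)%N :> nat & (s (p k) < p k)%N]].
  have [mid_k|out_k] := boolP (m <= k < n - m)%N.
    by constructor 2; rewrite sp /t /std_involution mid_k.
  have t_k : t k = (n - k.+1)%N :> nat by rewrite /t /std_involution (negPf out_k).
  have [lt_k|le_k] := ltnP k m; first by constructor 1; split=> //; apply: p_low.
  constructor 3; split=> //; first by move: out_k; lia.
  rewrite sp -{2}[k]tK -(sp (t k)) p_low // t_k; have := ltn_ord k; lia.
exists e'; split.
  split=> //; last first.
    by apply/block_form_normal; exists t; rewrite // orbit_std_involution.
  apply/(normal_triangularP e'_basis e'_normal tr) => a b c le_ac.
  rewrite !e'E; apply/eqP; apply: contraTT le_ac; rewrite -ltnNge => T0.
  have T_eq0 := (normal_triangularP e_basis e_normal tr).1 e_tri.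
  (* A nonzero value yields two inequalities, the second by exchanging the outer arguments of the
     symmetric trilinear form. *)
  have lt_ca : (s (p c) < p a)%N.
    by rewrite ltnNge; apply: contraNN T0 => /T_eq0 ->.
  have lt_ac : (s (p a) < p c)%N.
    rewrite ltnNge; apply: contraNN T0 => le_ca.
    by rewrite tr form_sym (mulC (tnth e (p b))) T_eq0.
  have mono (k l : 'I_n) : (k < m)%N -> (l < m)%N -> (p k < p l)%N -> (k < l)%N.
    move=> lt_km lt_lm lt_kl; rewrite ltnNge leq_eqVlt.
    apply/norP; split; first by apply: contraTneq lt_kl => /val_inj ->; rewrite ltnn.
    by apply/negP=> lt_lk; have := p_mono l k; rewrite lt_lk lt_km => /(_ isT); lia.
  have lt_an := ltn_ord a; have lt_cn := ltn_ord c.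
  (* Arithmetic settles all pairs of zones but two: [a] first and [c] last, or the reverse. There
     the last position is reflected into the first group, on which [p] is increasing. *)
  have [[lt_a t_a pa]|[mid_a _ pa]|[ge_a t_a pa]] := zone a;
    have [[lt_c t_c pc]|[mid_c t_c pc]|[ge_c t_c pc]] := zone c;
    rewrite ?t_c; try lia.
  - rewrite -t_c; apply: mono; rewrite -?sp //.
    by rewrite t_c; lia.
  - suff: (t a < c)%N by rewrite t_a; lia.
    apply: mono; rewrite -?sp //.
    by rewrite t_a; lia.
move=> k l le_k lt_kl lt_l; rewrite !e'E.
have sign (i : 'I_n) : (m <= i < n - m)%N ->
    gamma (tnth e (p i)) (tnth e (p i)) = 1 \/
    gamma (tnth e (p i)) (tnth e (p i)) = -1.
  move=> mid_i; have [_ _ _] := e_normal (p i) (in_setT _).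
  by rewrite sp /t /std_involution mid_i eqxx !mxE.
(* Both values are 1 or -1; only the value 1 at [l] needs the sorting. *)
have := p_sort k l le_k lt_kl lt_l; rewrite /plus.
have [|->|-> _] := sign l; first by rewrite lt_l (leq_trans le_k (ltnW lt_kl)).
  by rewrite eqxx => /(_ isT)/eqP->.
have [|->|->] := sign k; rewrite ?lexx ?le_k ?(ltn_trans lt_kl) //.
by rewrite (le_trans (lerN10 _)) ?ler01.
Qed.

Theorem theorem5p5 (R : realType) (J : vectType R) (n : nat)
  (mul : {bilinear J -> J -> J}) (gamma : {symmetric J}) (b : n.-tuple J)
  (b_basis : basis_of {:J} b)
  (mul_jordan : jordan mul) (mul_nilpotent : nilpotent_algebra mul)
  (gamma_metrised : metrised mul gamma)
  (det_gamma : \det (gram gamma b) = 1 \/ \det (gram gamma b) = -1) :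
  (exists (e : n.-tuple J) (S : {set {set 'I_n}}),
     semi_canonical mul gamma e S) /\
  (forall (e : n.-tuple J) (S : {set {set 'I_n}}) (m : nat),
     semi_canonical mul gamma e S -> m = num_two_blocks S ->
     exists e' : n.-tuple J,
       semi_canonical mul gamma e' (std_partition n m) /\
       (forall k l : 'I_n, (m <= k)%N -> (k < l)%N -> (l < n - m)%N ->
          gamma (tnth e' l) (tnth e' l) <= gamma (tnth e' k) (tnth e' k))).
Proof.
have [mulC _] := mul_jordan; have [tr nondeg] := gamma_metrised.
split=> [|e S _ e_sc ->]; last exact: semi_canonical_std mulC tr e_sc.
exact: (semi_canonical_exists (size_basis b_basis) mulC mul_nilpotent nondeg).
Qed.
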